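(* The following statements hold. (1) Define $K(n):=\max\{k\geq 1: k!<n\}$. For all sufficiently large $n$, \[ \mathcal{P}(n)\geq K(n)-1\geq (1-o(1))\frac{\log n}{\log\log n}, \] where $o(1)$ denotes a quantity tending to $0$ as $n\to\infty$. (2) For all sufficiently large $n$, \[ \mathcal{E}(n)\geq \left\lfloor \frac{\log(n-1)}{\log 2}\right\rfloor\geq \frac{\log n}{\log 2}-2. \]
   Context: Logarithms are natural. For integers $b$ and $k\ge 1$, $b\bmod k$ denotes the least nonnegative residue of $b$ modulo $k$. Pierce-type length: for integers $1\le a\le n$, set $a_0:=a$ and, as long as $a_j>0$, $a_{j+1}:=n\bmod a_j$. Let $\mathcal P(n,a)$ be the least integer $j\ge 1$ for which $a_j=0$, and $\mathcal P(n):=\max_{1\le a\le n}\mathcal P(n,a)$. Engel-type length: for integers $1\le a\le n$, set $a_0:=a$ and, as long as $a_j>0$, $a_{j+1}:=(-n)\bmod a_j$. Let $\mathcal E(n,a)$ be the least integer $j\ge 1$ for which $a_j=0$, and $\mathcal E(n):=\max_{1\le a\le n}\mathcal E(n,a)$. *)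

(* Defs.v *)
From HB Require Import structures.
From mathcomp Require Import all_boot all_order all_algebra.
From mathcomp Require Import zify.

Set Implicit Arguments.
Unset Strict Implicit.
Unset Printing Implicit Defensive.

(* For k >= 1, modz returns the least nonnegative residue, so the absolute     *)
(* value only changes the type.                                               *)
Definition residue (b : int) (k : nat) : nat := absz (b %% Posz k)%Z.

(* a_0 = a and a_(j+1) = b mod a_j; the terms after the first zero are junk    *)
(* (residue b 0 = |b|) and play no role in the lengths below.                *)
Definition residue_seq (b : int) (a j : nat) : nat := iter j (residue b) a.

Lemma residue_lt (b : int) (k : nat) : (0 < k)%N -> (residue b k < k)%N.
Proof.
move=> k_gt0; rewrite /residue.
have k0 : Posz k != 0%R by rewrite eqz_nat -lt0n.
have := modz_ge0 b k0; have := ltz_pmod b (d := Posz k); lia.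
Qed.

Lemma residue_seq_ends (b : int) (a : nat) :
  exists j, (0 < j)%N && (residue_seq b a j == 0%N).
Proof.
have pos m c : (0 < c <= m)%N -> exists j, (0 < j)%N && (residue_seq b c j == 0%N).
  elim: m c => [|m IHm] c; first by lia.
  case/andP=> c_gt0 c_le; have := residue_lt b c_gt0.
  have [r0 _|r_gt0 r_lt] := posnP (residue b c).
    by exists 1%N; rewrite /residue_seq /= r0.
  have [|j /andP[_ /eqP j0]] := IHm (residue b c); first by lia.
  by exists j.+1; rewrite /residue_seq iterSr -/(residue_seq _ _ _) j0.
have [->|a_gt0] := posnP a; last by apply: (pos a a); rewrite a_gt0 /=.
have r0 : residue b 0 = absz b by rewrite /residue modz0.
have [b0|b_gt0] := posnP (absz b).
  by exists 1%N; rewrite /residue_seq /= r0 b0.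
have [|j /andP[_ /eqP j0]] := pos (absz b) (absz b); first by rewrite b_gt0 /=.
by exists j.+1; rewrite /residue_seq iterSr r0 -/(residue_seq _ _ _) j0.
Qed.

Definition residue_length (b : int) (a : nat) : nat :=
  ex_minn (residue_seq_ends b a).

Definition pierce_length (n a : nat) : nat := residue_length (Posz n) a.
Definition engel_length (n a : nat) : nat := residue_length (- Posz n)%R a.

Definition pierce_max (n : nat) : nat :=
  \max_(1 <= a < n.+1) pierce_length n a.
Definition engel_max (n : nat) : nat :=
  \max_(1 <= a < n.+1) engel_length n a.

(* The maximum of the k >= 1 with k! < n; the bound k <= n loses nothing as    *)
(* k <= k!, and the set is nonempty as soon as n >= 2.                        *)
Definition factorial_max (n : nat) : nat :=
  \max_(1 <= k < n.+1 | (k`! < n)%N) k.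

(* Main.v *)
Require Import Defs.
From mathcomp Require Import all_boot all_order all_algebra.
From mathcomp Require Import all_classical all_reals all_analysis.
From mathcomp Require Import zify ring lra.

Set Implicit Arguments.
Unset Strict Implicit.
Unset Printing Implicit Defensive.

Import Order.TTheory GRing.Theory Num.Theory.
Import numFieldNormedType.Exports.
Local Open Scope classical_set_scope.
Local Open Scope ring_scope.

(** Both lower bounds come from sequences of remainders whose quotients are
    prescribed in advance.  A sequence of positive integers that decreases
    strictly and satisfies b = q_j * x_j + x_(j+1) is the remainder sequence of
    b started at x_0, so its number of terms bounds the length from below
    (residue_length_chain).

    Pierce lengths: take the quotients 1, 2, 3, ..., that is
    x_(j+1) = n - (j+1) * x_j.  Dividing by n, the starting points whose first
    quotients are 1, ..., k-1 fill an interval of length 1 / k!, and an interval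
    longer than 1 / n contains a multiple of 1 / n, so k! < n is what is needed.
    In integers: x_(k-1) depends affinely on x_0 with slope plus or minus
    (k-1)!, so x_0 can be chosen with 1 <= x_(k-1) <= (k-1)!
    (pierce_chain_end); then k * x_(k-1) < n, and going back along the chain
    this inequality forces all earlier terms to be positive and decreasing
    (pierce_chain_back).  Hence k <= P(n) whenever k! < n.

    Engel lengths: all quotients equal to 2 and a = n - 1 give
    x_j = n - 2 ^ j, which stays positive as long as 2 ^ j < n.

    Asymptotics: put L = ln n and m = K(n) + 1, so that n <= m!.  Once ln L >= 1,
    either m >= L, and then m >= L / ln L at once, or m < L and
    L <= ln m! <= m ln m <= m ln L.  In both cases K(n) - 1 >= L / ln L - 2,
    which is (1 - eps) * L / ln L for eps = 2 ln L / L, and eps tends to 0. *)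

(** * Remainder sequences with prescribed quotients *)

Lemma residue_eq (b q : int) (k r : nat) :
  b = q * k%:Z + r%:Z -> (r < k)%N -> residue b k = r.
Proof.
move=> -> rk; rewrite /residue modzMDl modz_nat absz_nat.
exact: modn_small.
Qed.

(** The conditions say that x_(j+1) is the remainder of b by x_j with quotient
    q_j.  The Pierce and Engel bounds are the cases b = n with q_j = j + 1 and
    b = - n with q_j = - 2. *)
Lemma residue_length_chain (b : int) (q x : nat -> int) (m : nat) :
  (forall j, (j <= m)%N -> 0 < x j) ->
  (forall j, (j < m)%N -> b = q j * x j + x j.+1 /\ x j.+1 < x j) ->
  (m < residue_length b `|x 0%N|)%N.
Proof.
move=> x_gt0 x_step.
have seqE j : (j <= m)%N -> residue_seq b `|x 0%N| j = `|x j|%N.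
  elim: j => [//|j IHj] jm.
  have [bE x_lt] := x_step j jm.
  have xj_gt0 := x_gt0 j (ltnW jm); have xj1_gt0 := x_gt0 j.+1 jm.
  rewrite /residue_seq iterS -/(residue_seq _ _ _) IHj; last exact: ltnW.
  apply: (@residue_eq b (q j)); last by lia.
  by rewrite !gez0_abs ?ltW.
rewrite /residue_length; case: ex_minnP => l /andP[l_gt0 /eqP xl0] _.
rewrite ltnNge; apply/negP => lm.
by have := x_gt0 l lm; move: xl0; rewrite seqE//; lia.
Qed.

(** * Pierce lengths: the quotients 1, 2, 3, ... *)

(** The values are integers, possibly negative, because truncated subtraction
    would break the affine dependence on the starting point a. *)
Fixpoint pierce_chain (n a : int) (j : nat) : int :=
  if j is i.+1 then n - i.+1%:Z * pierce_chain n a i else a.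

Lemma pierce_chain_affine (n a : int) (j : nat) :
  pierce_chain n a j = (-1) ^+ j * j`!%:Z * a + pierce_chain n 0 j.
Proof.
elim: j => [|j IHj] /=; first by rewrite expr0 fact0; ring.
by rewrite IHj factS PoszM exprS; ring.
Qed.

(** By affinity the m-th term runs through a whole residue class modulo m! when
    a runs through the integers, and every class has a representative in
    [1, m!]. *)
Lemma pierce_chain_end (n : int) (m : nat) :
  exists a, 1 <= pierce_chain n a m <= m`!%:Z.
Proof.
set c := pierce_chain n 0 m; set d := m`!%:Z.
have d_gt0 : 0 < d by rewrite /d ltz_nat fact_gt0.
(* The sign cancels that of the slope; c - 1 in place of c moves the usual
   range [0, d - 1] of remainders to [1, d]. *)
exists (- (-1) ^+ m * ((c - 1) %/ d)%Z); rewrite pierce_chain_affine -/c -/d.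
have -> : (-1) ^+ m * d * (- (-1) ^+ m * ((c - 1) %/ d)%Z) + c
        = ((c - 1) %% d)%Z + 1.
  have s2 : (-1) ^+ m * (-1) ^+ m = 1 :> int.
    by rewrite -exprD addnn -signr_odd odd_double.
  have e := divz_eq (c - 1) d.
  have -> : (-1) ^+ m * d * (- (-1) ^+ m * ((c - 1) %/ d)%Z) + c =
            - ((-1) ^+ m * (-1) ^+ m) * (((c - 1) %/ d)%Z * d) + c by ring.
  by rewrite s2; lia.
have := modz_ge0 (c - 1) (lt0r_neq0 d_gt0); have := ltz_pmod (c - 1) d_gt0.
by lia.
Qed.

(** Writing x, y for the terms of index j and j+1, where y = n - (j+1) x: the
    bound y < n / (j+2) gives (j+1) x > n (j+1) / (j+2), hence x > n / (j+2),
    which yields both x > 0 and y < x; and y > 0 gives (j+1) x < n, so the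
    hypotheses propagate to index j. *)
Lemma pierce_chain_back (n a : int) (j : nat) :
  0 < pierce_chain n a j.+1 -> j.+2%:Z * pierce_chain n a j.+1 < n ->
  [/\ 0 < pierce_chain n a j, j.+1%:Z * pierce_chain n a j < n &
      pierce_chain n a j.+1 < pierce_chain n a j].
Proof.
move=> /=; move: (pierce_chain n a j) => x y_gt0 y_lt.
have x_big : n < j.+2%:Z * x.
  have : j.+1%:Z * n < j.+1%:Z * (j.+2%:Z * x) by nia.
  by rewrite ltr_pM2l.
by split; nia.
Qed.

Lemma pierce_chain_bounds (n a : int) (m : nat) :
  0 < pierce_chain n a m -> m.+1%:Z * pierce_chain n a m < n ->
  forall j, (j <= m)%N ->
    0 < pierce_chain n a j /\ j.+1%:Z * pierce_chain n a j < n.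
Proof.
elim: m => [|m IHm] x_gt0 x_lt j; first by rewrite leqn0 => /eqP ->.
rewrite leq_eqVlt => /predU1P[-> //|].
have [y_gt0 y_lt _] := pierce_chain_back x_gt0 x_lt.
exact: IHm.
Qed.

(** With k = m + 1, a last term in [1, m!] satisfies (m + 1) x_m <= k! < n, which
    starts the descent along the chain; its k terms x_0, ..., x_m are all
    positive. *)
Lemma factorial_lt_pierce_max (n k : nat) :
  (k`! < n)%N -> (k <= pierce_max n)%N.
Proof.
case: k => [//|m] kn.
have [a /andP[a_ge1 a_le]] := pierce_chain_end n%:Z m.
have bounds := @pierce_chain_bounds n%:Z a m.
have {}bounds : forall j, (j <= m)%N ->
    0 < pierce_chain n%:Z a j /\ j.+1%:Z * pierce_chain n%:Z a j < n%:Z.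
  apply: bounds; first by lia.
  by move: kn; rewrite factS; nia.
have [/= a_gt0 a_lt] := bounds 0%N isT.
have : (m < pierce_length n `|a|)%N.
  apply: (@residue_length_chain _ (fun j => j.+1%:Z) (pierce_chain n%:Z a)).
    by move=> j /bounds[].
  move=> j jm; split; first by rewrite /=; ring.
  have [y_gt0 y_lt] := bounds j.+1 jm.
  by have [] := pierce_chain_back y_gt0 y_lt.
move=> /leq_trans; apply; apply: leq_bigmax_seq => //.
by rewrite mem_index_iota; lia.
Qed.

Lemma factorial_max_le_pierce_max (n : nat) :
  (factorial_max n <= pierce_max n)%N.
Proof.
by apply/bigmax_leqP_seq => k _; exact: factorial_lt_pierce_max.
Qed.

Lemma leq_factorial_max_succ (n : nat) : (n <= (factorial_max n).+1`!)%N.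
Proof.
rewrite leqNgt; apply/negP => Kn.
suff : ((factorial_max n).+1 <= factorial_max n)%N by rewrite ltnn.
apply: (@leq_bigmax_seq _ _ (fun k : nat => (k`! < n)%N) id) => //.
rewrite mem_index_iota /= ltnS; apply: leq_trans (ltnW Kn).
by apply: dvdn_leq; rewrite ?fact_gt0// dvdn_fact//=.
Qed.

(** * Engel lengths: all quotients equal to 2 *)

(** The chain starting at n - 1 with x_(j+1) = 2 x_j - n is n - 2 ^ j. *)
Lemma pow2_lt_engel_max (n m : nat) : (2 ^ m < n)%N -> (m < engel_max n)%N.
Proof.
move=> mn.
have n_gt1 : (1 < n)%N by apply: leq_ltn_trans mn; rewrite expn_gt0.
have pow_lt j : (j <= m)%N -> (2 ^ j < n)%N.
  by move=> jm; apply: leq_ltn_trans mn; rewrite leq_exp2l.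
have := @residue_length_chain (- n%:Z) (fun=> - 2) (fun j => n%:Z - (2 ^ j)%:Z) m.
have -> : `|n%:Z - (2 ^ 0)%:Z|%N = n.-1 by rewrite expn0; lia.
move=> len; apply: (@leq_trans (engel_length n n.-1)).
  apply: len => [j /pow_lt|j _]; first by rewrite subr_gt0 ltz_nat.
  by rewrite expnS; have := expn_gt0 2 j; split; lia.
by apply: leq_bigmax_seq => //; rewrite mem_index_iota; lia.
Qed.

(** * Asymptotics *)

Lemma cvgy_ln (R : realType) :
  ln x @[x --> (+oo : set_system R)] --> (+oo : set_system R).
Proof.
apply/cvgryPge => A; near=> x.
have x_gt0 : 0 < x by near: x; exact: nbhs_pinfty_gt.
have x_ge : expR A <= x by near: x; exact: nbhs_pinfty_ge.
by rewrite -[A]expRK ler_ln ?posrE ?expR_gt0.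
Unshelve. all: by end_near. Qed.

(** The inequality ln y < y at y = c x with c = e / 2 bounds ln x by
    c x - ln c, and the constant is absorbed by a second c x for large x. *)
Lemma cvgy_ln_div (R : realType) :
  ln x / x @[x --> (+oo : set_system R)] --> (0 : R).
Proof.
apply/cvgr0Pnorm_le => e e_gt0; near=> x.
have c_gt0 : 0 < e / 2 by lra.
have x_ge1 : 1 <= x by near: x; exact: nbhs_pinfty_ge.
have x_gt0 : 0 < x by lra.
rewrite ger0_norm; last by rewrite divr_ge0 ?ln_ge0// ltW.
rewrite ler_pdivrMr//.
have := @ln_sublinear _ (e / 2 * x); rewrite mulr_gt0// => /(_ isT).
rewrite lnM ?posrE//.
have : - ln (e / 2) / (e / 2) <= x.
  by near: x; apply: nbhs_pinfty_ge; exact: num_real.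
by rewrite ler_pdivrMr// => x_ge; lra.
Unshelve. all: by end_near. Qed.

Lemma factorial_ln_le (R : realType) (m : nat) :
  ln m`!%:R <= m%:R * ln m%:R :> R.
Proof.
case: m => [|m]; first by rewrite fact0 ln1 mul0r.
rewrite mulr_natl -lnXn ?ltr0n// ler_ln ?posrE ?exprn_gt0 ?ltr0n ?fact_gt0//.
rewrite -natrX ler_nat.
have powS k : (k <= m.+1)%N -> (k`! <= m.+1 ^ k)%N.
  elim: k => [//|k IHk] km.
  by rewrite factS expnS leq_mul// IHk// ltnW.
exact: powS.
Qed.

(** If m >= ln n there is nothing to do, as ln (ln n) >= 1; otherwise
    ln m < ln (ln n) can be used in ln n <= ln m! <= m ln m. *)
Lemma factorial_ge_ln (R : realType) (m n : nat) :
  (n <= m`!)%N -> 1 <= ln (ln n%:R) :> R ->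
  ln n%:R / ln (ln n%:R) <= m%:R :> R.
Proof.
set L := ln n%:R => nm l_ge1; have l_gt0 : 0 < ln L by lra.
have L_gt0 : 0 < L by rewrite ltNge; apply/negP => /ln0 L0; lra.
have n_gt0 : (0 < n)%N.
  by rewrite lt0n; apply/eqP => n0; move: L_gt0; rewrite /L n0 ln0// ltxx.
rewrite ler_pdivrMr//; have [Lm|mL] := leP L m%:R.
  by apply: le_trans Lm _; rewrite ler_peMr.
have m_gt0 : (0 < m)%N.
  case: m nm {mL} => [n_le1|//].
  suff : L <= 0 by rewrite leNgt L_gt0.
  by rewrite /L ln_le0// (ler_nat R n 1).
apply: le_trans (_ : ln m`!%:R <= _).
  by rewrite ler_ln ?posrE ?ltr0n ?fact_gt0// ler_nat.
apply: le_trans (factorial_ln_le R m) _.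
by rewrite ler_wpM2l ?ler0n// ler_ln ?posrE ?ltr0n// ltW.
Qed.

(** The error term 2 ln (ln n) / ln n is chosen so that the left-hand side is
    exactly ln n / ln (ln n) - 2; the loss of 2 pays for passing from K(n) + 1,
    whose factorial is at least n, to K(n) - 1. *)
Lemma factorial_max_lower (R : realType) (n : nat) :
  1 <= ln (ln n%:R) :> R ->
  (1 - 2 * (ln (ln n%:R) / ln n%:R)) * (ln n%:R / ln (ln n%:R))
    <= (factorial_max n)%:R - 1 :> R.
Proof.
move=> l_ge1; have := factorial_ge_ln (leq_factorial_max_succ n) l_ge1.
have L_neq0 : ln n%:R != 0 :> R.
  by apply/eqP => L0; move: l_ge1; rewrite L0 ln0//; lra.
have l_neq0 : ln (ln n%:R) != 0 :> R by lra.
set K := factorial_max n; move=> LK.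
have -> : (1 - 2 * (ln (ln n%:R) / ln n%:R)) * (ln n%:R / ln (ln n%:R))
        = ln n%:R / ln (ln n%:R) - 2 :> R by field; rewrite L_neq0 l_neq0.
by move: LK; rewrite -natr1; lra.
Qed.

Lemma floor_log2_le_engel_max (R : realType) (n : nat) : (1 < n)%N ->
  (Num.floor (ln (n%:R - 1) / ln 2 : R))%:~R <= (engel_max n)%:R :> R.
Proof.
move=> n_gt1; set z := ln _ / ln _.
have ln2_gt0 : 0 < ln 2 :> R by rewrite ln_gt0// ltr1n.
have n1_ge1 : 1 <= n%:R - 1 :> R.
  by rewrite lerBrDr -[1 + 1]/(2%:R) ler_nat.
have z_ge0 : 0 <= z by rewrite divr_ge0 ?ln_ge0 ?ler1n.
have : 0 <= Num.floor z by rewrite floor_ge0.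
have := Num.Theory.floor_le z; case: (Num.floor z) => // m mz _.
rewrite -pmulrn ler_nat; apply/ltnW/pow2_lt_engel_max.
move: mz; rewrite /z -pmulrn ler_pdivlMr// mulr_natl -lnXn//.
rewrite ler_ln ?posrE ?exprn_gt0//; last by lra.
by rewrite lerBrDr -natrX natr1 ler_nat.
Qed.

(** Replacing n by n - 1 costs at most 1, as n <= 2 (n - 1), and the floor costs
    at most 1 more. *)
Lemma log2_le_floor (R : realType) (n : nat) : (1 < n)%N ->
  ln n%:R / ln 2 - 2 <= (Num.floor (ln (n%:R - 1) / ln 2 : R))%:~R :> R.
Proof.
move=> n_gt1; set z := ln (_ - _) / ln _.
have ln2_gt0 : 0 < ln 2 :> R by rewrite ln_gt0// ltr1n.
have n1_ge1 : 1 <= n%:R - 1 :> R.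
  by rewrite lerBrDr -[1 + 1]/(2%:R) ler_nat.
have : ln n%:R / ln 2 - 1 <= z.
  rewrite /z lerBlDr ler_pdivrMr// mulrDl mul1r divfK ?gt_eqF//.
  rewrite -lnM ?posrE//; last by lra.
  by rewrite ler_ln ?posrE; lra.
by have := floorD1_gt z; rewrite intrD; lra.
Qed.

Theorem theorem1p5 (R : realType) :
  (exists2 eps : nat -> R, eps n @[n --> \oo] --> (0 : R) &
     \forall n \near \oo,
       (factorial_max n)%:R - 1 <= (pierce_max n)%:R :> R /\
       (1 - eps n) * (ln n%:R / ln (ln n%:R))
         <= (factorial_max n)%:R - 1 :> R) /\
  (\forall n \near \oo,
     (Num.floor (ln (n%:R - 1) / ln 2 : R))%:~R <= (engel_max n)%:R :> R /\
     ln n%:R / ln 2 - 2 <= (Num.floor (ln (n%:R - 1) / ln 2 : R))%:~R :> R).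
Proof.
have ln_y : (ln n%:R : R) @[n --> \oo] --> (+oo : set_system R).
  exact: cvg_comp (@cvgr_idn R) (@cvgy_ln R).
have lnln_y : (ln (ln n%:R) : R) @[n --> \oo] --> (+oo : set_system R).
  exact: cvg_comp ln_y (@cvgy_ln R).
split.
  exists (fun n => 2 * (ln (ln n%:R) / ln n%:R)).
    rewrite -[0](mulr0 2); apply: cvgM; first exact: cvg_cst.
    exact: cvg_comp ln_y (@cvgy_ln_div R).
  near=> n; split.
    apply: (@le_trans _ _ (factorial_max n)%:R); first by lra.
    by rewrite ler_nat factorial_max_le_pierce_max.
  apply: factorial_max_lower; near: n.
  by move/cvgryPge: lnln_y; exact.
near=> n; have n_gt1 : (1 < n)%N by near: n; exact: nbhs_infty_gt.
by split; [exact: floor_log2_le_engel_max|exact: log2_le_floor].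
Unshelve. all: by end_near. Qed.
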